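(* Let $a\in(0,1)$ and let $a_0$ be the unique solution of $27a^2-54a^3=-1$ in the interval $(1/2,2/3)$. (i) If $a\in[a_0,1)$, then $F_a'(x)$ diverges (that is, fails to exist) for almost all $x\in[0,1]$. (ii) If $a\in(0,1/3)\cup(1/3,a_0)$, then $F_a'(x)=0$ for almost all $x\in[0,1]$. (iii) If $a=1/3$, then $F_a'(x)=1$ for all $x\in[0,1]$.
   Context: For $a\in(0,1)$ the function $F_a:[0,1]\to[0,1]$ is defined as follows. Define continuous functions $f_i:[0,1]\to[0,1]$, $i\ge 0$, inductively: $f_0(x)=x$ for all $x\in[0,1]$; each $f_i$ is continuous on $[0,1]$ and affine on each subinterval $[k/3^i,(k+1)/3^i]$, $k\in\{0,1,\ldots,3^i-1\}$; and for all $i\ge 0$ and $k\in\{0,1,\ldots,3^i-1\}$, $$f_{i+1}\left(\frac{k}{3^i}\right)=f_i\left(\frac{k}{3^i}\right),\qquad f_{i+1}\left(\frac{3k+1}{3^{i+1}}\right)=f_i\left(\frac{k}{3^i}\right)+a\left[f_i\left(\frac{k+1}{3^i}\right)-f_i\left(\frac{k}{3^i}\right)\right],$$ $$f_{i+1}\left(\frac{3k+2}{3^{i+1}}\right)=f_i\left(\frac{k}{3^i}\right)+(1-a)\left[f_i\left(\frac{k+1}{3^i}\right)-f_i\left(\frac{k}{3^i}\right)\right],\qquad f_{i+1}\left(\frac{k+1}{3^i}\right)=f_i\left(\frac{k+1}{3^i}\right).$$ Then $F_a=\lim_{i\to\infty}f_i$. The derivative $F_a'(x)$ is said to exist when the difference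 quotient of $F_a$ at $x$ has a finite limit (one-sided at the endpoints $0$ and $1$). ''For almost all $x\in[0,1]$'' means for all $x$ in a subset of $[0,1]$ of Lebesgue measure $1$. *)

(* Defs.v *)
From mathcomp Require Import all_boot all_order all_algebra.
From mathcomp Require Import all_classical all_reals all_analysis.
From mathcomp Require Import ring lra zify.
Set Implicit Arguments.
Unset Strict Implicit.
Unset Printing Implicit Defensive.
Import Order.TTheory GRing.Theory Num.Theory.
Import numFieldNormedType.Exports.
Local Open Scope classical_set_scope.
Local Open Scope ring_scope.

Definition triadic {R : realType} (i k : nat) : R := k%:R / 3 ^+ i.

Definition affine_on {R : realType} (u v : R) (g : R -> R) : Prop :=
  exists c d : R, forall x, x \in `[u, v] -> g x = c * x + d.

(* Functions on [0, 1] are represented by total functions R -> R, whose values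
   outside [0, 1] are left unconstrained and never used. *)
Record okamoto_approximants {R : realType} (a : R) (f : nat -> R -> R) : Prop :=
  OkamotoApproximants {
    okamoto_maps : forall i x, x \in `[0, 1] -> f i x \in `[0, 1] ;
    okamoto_continuous : forall i, {within `[0, 1], continuous (f i)} ;
    okamoto_affine : forall i k, (k < 3 ^ i)%N ->
      affine_on (triadic i k) (triadic i k.+1) (f i) ;
    okamoto0 : forall x, x \in `[0, 1] -> f 0%N x = x ;
    okamoto_left : forall i k, (k < 3 ^ i)%N ->
      f i.+1 (triadic i k) = f i (triadic i k) ;
    okamoto_third : forall i k, (k < 3 ^ i)%N ->
      f i.+1 (triadic i.+1 (3 * k + 1)) =
      f i (triadic i k) + a * (f i (triadic i k.+1) - f i (triadic i k)) ;
    okamoto_two_thirds : forall i k, (k < 3 ^ i)%N ->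
      f i.+1 (triadic i.+1 (3 * k + 2)) =
      f i (triadic i k) + (1 - a) * (f i (triadic i k.+1) - f i (triadic i k)) ;
    okamoto_right : forall i k, (k < 3 ^ i)%N ->
      f i.+1 (triadic i k.+1) = f i (triadic i k.+1)
  }.

Definition limit_fun {R : realType} (f : nat -> R -> R) (x : R) : R :=
  lim (f i x @[i --> \oo]).

(* l is the finite limit at x of the difference quotient of F, the increment
   being restricted to [0, 1]: two-sided if 0 < x < 1, one-sided at 0 and 1. *)
Definition is_derive01 {R : realType} (F : R -> R) (x l : R) : Prop :=
  (F y - F x) / (y - x) @[y --> within `[0, 1] x^'] --> l.

Definition derivable01 {R : realType} (F : R -> R) (x : R) : Prop :=
  exists l : R, is_derive01 F x l.

Section Existence.
Variables (R : realType) (a : R).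

Fixpoint nodeval (i k : nat) : R :=
  if i is j.+1 then
    let l := nodeval j (k %/ 3) in
    let d := nodeval j (k %/ 3).+1 - l in
    match (k %% 3)%N with
    | 0 => l
    | 1 => l + a * d
    | _ => l + (1 - a) * d
    end
  else k%:R.

Definition interp (i : nat) (x : R) : R :=
  let k := Num.truncn (x * 3 ^+ i) in
  nodeval i k + (x * 3 ^+ i - k%:R) * (nodeval i k.+1 - nodeval i k).

Let e3_gt0 i : (0 : R) < 3 ^+ i. Proof. by rewrite exprn_gt0. Qed.

Lemma interp_itv i k x : x \in `[triadic i k, triadic i k.+1] ->
  interp i x =
  nodeval i k + (x * 3 ^+ i - k%:R) * (nodeval i k.+1 - nodeval i k).
Proof.
rewrite in_itv /= /triadic ler_pdivrMr // ler_pdivlMr // => /andP[kx xk].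
rewrite /interp; move: xk; rewrite le_eqVlt => /orP[/eqP ->|xk].
  by rewrite natrK subrr mul0r addr0 -natr1; ring.
by rewrite (@truncn_def _ _ k) // kx xk.
Qed.

Lemma interp_node i k : interp i (triadic i k) = nodeval i k.
Proof. by rewrite /interp /triadic divfK ?gt_eqF // natrK subrr mul0r addr0. Qed.

Lemma triadicS i k : triadic i.+1 (3 * k) = triadic i k :> R.
Proof.
rewrite /triadic exprS natrM; have := e3_gt0 i => h; field.
by rewrite gt_eqF.
Qed.

Lemma ler_triadic i m n : (m <= n)%N -> triadic i m <= triadic i n :> R.
Proof. by move=> mn; rewrite /triadic ler_pM2r ?invr_gt0 // ler_nat. Qed.

Lemma triadic0 i : triadic i 0 = 0 :> R.
Proof. by rewrite /triadic mul0r. Qed.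

Lemma triadic1 i : triadic i (3 ^ i) = 1 :> R.
Proof. by rewrite /triadic natrX divff ?gt_eqF. Qed.

Lemma triadic_cover i x : x \in `[0, 1] ->
  exists2 k, (k < 3 ^ i)%N & x \in `[(triadic i k : R), triadic i k.+1].
Proof.
rewrite in_itv /= => /andP[x0 x1].
have y0 : 0 <= x * 3 ^+ i by rewrite mulr_ge0 // ltW.
move: x1; rewrite le_eqVlt => /orP[/eqP ->|x1].
  have p : (0 < 3 ^ i)%N by rewrite expn_gt0.
  exists (3 ^ i).-1; first by rewrite prednK.
  by rewrite in_itv /= prednK // triadic1 lexx andbT -(triadic1 i) ler_triadic // leq_pred.
have /andP[h1 h2] := truncn_itv y0.
exists (Num.truncn (x * 3 ^+ i)).
  rewrite -(ltr_nat R) natrX (le_lt_trans h1) // -[ltRHS]mul1r ltr_pM2r //.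
by rewrite in_itv /= /triadic ler_pdivrMr // ler_pdivlMr // h1 ltW.
Qed.

Lemma nodeval_itv i k : 0 < a < 1 -> (k <= 3 ^ i)%N -> 0 <= nodeval i k <= 1.
Proof.
move=> a01; elim: i k => [|i IH] k; first by rewrite expn0 /=; case: k => [|[|]] //; rewrite ?lexx ?ler01.
rewrite expnS => km /=; have hq : (k %/ 3 <= 3 ^ i)%N by lia.
have hl := IH _ hq.
case E: (k %% 3)%N => [//|r].
have hr : ((k %/ 3).+1 <= 3 ^ i)%N by lia.
by have {IH} := IH _ hr; case: r E => [|r] _; nra.
Qed.

Lemma interp_continuous i : {within `[0, 1], continuous (interp i)}.
Proof.
suff H m : (m <= 3 ^ i)%N -> {within `[0, triadic i m], continuous (interp i)}.
  by have := H _ (leqnn _); rewrite triadic1.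
elim: m => [_|m IH hm].
  by rewrite triadic0 set_itv1; exact: continuous_subspace1.
have -> : `[0, triadic i m.+1]%classic =
    `[0, triadic i m]%classic `|` `[(triadic i m : R), triadic i m.+1]%classic.
  have h0 : (0 : R) <= triadic i m by rewrite -(triadic0 i) ler_triadic.
  have h1 : triadic i m <= triadic i m.+1 :> R by rewrite ler_triadic.
  apply/seteqP; split => x /=; rewrite !in_itv /=.
    move=> /andP[x0 x1]; case: (leP x (triadic i m)) => hx.
      by left; rewrite x0.
    by right; rewrite (ltW hx).
  move=> [/andP[u v]|/andP[u v]]; apply/andP; split=> //.
    exact: le_trans h1.
  exact: le_trans u.
apply: withinU_continuous.
- exact: itv_closed.
- exact: itv_closed.
- by apply: IH; exact: ltnW.
apply: (@subspace_eq_continuous _ _ _ (fun x : R => nodeval i m +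
  (x * 3 ^+ i - m%:R) * (nodeval i m.+1 - nodeval i m))).
  by move=> x /set_mem /= hx; rewrite /from_subspace (interp_itv hx).
apply: continuous_subspaceT => x.
apply: cvgD; first exact: cvg_cst.
apply: cvgMr_tmp; apply: cvgB; last exact: cvg_cst.
by apply: cvgMr_tmp; exact: cvg_id.
Qed.

Lemma okamoto_approximants_exist : 0 < a < 1 -> okamoto_approximants a interp.
Proof.
move=> a01; split.
- move=> i x /(triadic_cover i)[k hk hx]; rewrite (interp_itv hx).
  have h0 := nodeval_itv a01 (ltnW hk); have h1 := nodeval_itv a01 hk.
  move: hx; rewrite !in_itv /= /triadic ler_pdivrMr // ler_pdivlMr //.
  rewrite -natr1; set y := x * _; nra.
- exact: interp_continuous.
- move=> i k hk; exists (3 ^+ i * (nodeval i k.+1 - nodeval i k)).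
  exists (nodeval i k - k%:R * (nodeval i k.+1 - nodeval i k)).
  by move=> x /interp_itv ->; ring.
- move=> x _; rewrite /interp /= expr0 mulr1 -natr1; ring.
- by move=> i k hk; rewrite -triadicS !interp_node /= mulKn // modnMr triadicS interp_node.
- move=> i k hk; rewrite !interp_node /=.
  by rewrite mulnC divnMDl // modnMDl addn0.
- move=> i k hk; rewrite !interp_node /=.
  by rewrite mulnC divnMDl // modnMDl addn0.
- by move=> i k hk; rewrite -triadicS !interp_node /= mulKn // modnMr triadicS interp_node.
Qed.

End Existence.

(* Main.v *)
Require Import Defs.
From mathcomp Require Import all_boot all_order all_algebra.
From mathcomp Require Import all_classical all_reals all_analysis.
From mathcomp Require Import ring lra zify.
Import Order.TTheory GRing.Theory Num.Theory.
Import numFieldNormedType.Exports.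
Local Open Scope classical_set_scope.
Local Open Scope ring_scope.

(** Cut [0, 1] into the 3^n cells [k/3^n, (k+1)/3^n]. Over such a cell the
increment of F_a is the product, over the n ternary digits of k, of a (digit 0
or 2) or 1 - 2a (digit 1), so the slope of F_a over the cell is
A^(n - o) * B^o with A = 3a, B = 3(1 - 2a) and o the number of digits 1
([okamoto_increment], [digit_prodE]). For a random point the digits are
independent and uniform, hence everything depends on the comparison of A^2 |B|
with 1. The cubic satisfies 1 - 27a^2(1 - 2a) = (3a - 1)^2 (6a + 1), and
a0 > 1/2 is the solution of 27a^2(2a - 1) = 1; so A^2 |B| >= 1 exactly when
a = 1/3 or a >= a0.

Case a >= a0. At a point of differentiability the slopes over the successive
cells that contain the point converge. The ratio of two consecutive slopes is A
or B, both at distance at least 1/2 from 1, so the slopes tend to 0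
([derivable01_low_walk]); since A^2 |B| >= 1, this forces o > n/3 from some n
on. The walk n - 3o goes up by 1 with probability 2/3 and down by 2 with
probability 1/3. It is centred, which covers the critical value a0, and it
almost surely exceeds every level: the probability d(l) of reaching level l is
decided by conditioning on the first digit, which gives
3 d(l+1) = 2 d(l) + d(l+3), and 1 is the only bounded solution with d(0) = 1
([survival_cvg0]). So the points with o > n/3 eventually form a null set
([negligible_low_walk]).

Case A^2 |B| < 1. For m large, 2 A^(1/m) + |B|^(1/m) < 3
([subunit_sum_of_roots]), so the mean of |slope|^(1/m) decays geometrically.
By Markov's inequality and Borel-Cantelli, almost every point x is eventually
far from every cell with slope above r^n, for some r < 1
([negligible_heavy_cells]). Enlarging each such cell by its two neighbours in
that argument controls, at x, the cells adjacent to the one containing x, and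
this is what is needed: if 3^-(n+1) <= |y - x| < 3^-n then x and y lie in equal
or adjacent cells of order n, and F_a varies on a cell by no more than its
increment over it ([oscillation_on_adjacent_cells], [is_derive01_eq0]).

Case a = 1/3. All slopes are 1 and F_a is the identity. *)

(** * Digits, products over digits, and sums over cells *)

Fixpoint ones (n k : nat) : nat :=
  if n is m.+1 then ((k %% 3)%N == 1%N) + ones m (k %/ 3)%N else 0.

(** The slope of F_a over the k-th cell of order n is of this form, with p = 3a
and q = 3(1 - 2a). *)
Fixpoint digit_prod {R : realType} (p q : R) (n k : nat) : R :=
  if n is m.+1 then
    digit_prod p q m (k %/ 3)%N * (if (k %% 3)%N == 1%N then q else p)
  else 1.

Lemma sum_last_digit (R : realType) (F : nat -> R) (n : nat) :
  \sum_(0 <= k < 3 ^ n.+1) F k =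
  \sum_(0 <= k < 3 ^ n) (F (3 * k)%N + F (3 * k + 1)%N + F (3 * k + 2)%N).
Proof.
rewrite expnSr big_nat_mul; apply: eq_bigr => i _.
rewrite mulSn mulnC -[X in \sum_(X <= _ < _) _]add0n big_addn addnK.
by rewrite !big_nat_recr //= big_nil add0r add0n addnC [(2 + _)%N]addnC.
Qed.

Lemma sum_first_digit (R : realType) (F : nat -> R) (n : nat) :
  \sum_(0 <= k < 3 ^ n.+1) F k =
  \sum_(0 <= k < 3 ^ n) (F k + F (k + 3 ^ n)%N + F (k + 2 * 3 ^ n)%N).
Proof.
rewrite expnS big_nat_mul !big_nat_recr //= big_nil add0r !big_split /=.
congr (_ + _ + _); first by rewrite mul0n mul1n.
  by rewrite -[X in \sum_(X <= _ < _) _]add0n big_addn mulSn addnK mul1n.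
by rewrite -[X in \sum_(X <= _ < _) _]add0n big_addn mulSn addnK.
Qed.

Lemma sum_digit_prod (R : realType) (p q : R) (n : nat) :
  \sum_(0 <= k < 3 ^ n) digit_prod p q n k = (2 * p + q) ^+ n.
Proof.
elim: n => [|n IHn]; first by rewrite big_nat1.
rewrite sum_last_digit exprSr -IHn mulr_suml; apply: eq_bigr => k _ /=.
have -> : (3 * k %% 3 = 0)%N by lia.
have -> : ((3 * k + 1) %% 3 = 1)%N by lia.
have -> : ((3 * k + 2) %% 3 = 2)%N by lia.
have -> : (3 * k %/ 3 = k)%N by lia.
have -> : ((3 * k + 1) %/ 3 = k)%N by lia.
have -> : ((3 * k + 2) %/ 3 = k)%N by lia.
by rewrite /=; ring.
Qed.

Lemma ones_le n k : (ones n k <= n)%N.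
Proof. by elim: n k => //= n IHn k; have := IHn (k %/ 3)%N; lia. Qed.

Lemma digit_prodE (R : realType) (p q : R) n k :
  digit_prod p q n k = p ^+ (n - ones n k) * q ^+ ones n k.
Proof.
elim: n k => [|n IHn] k /=; first by rewrite !expr0 mulr1.
have := ones_le n (k %/ 3)%N; rewrite IHn; set o := ones n _ => le_on.
case: eqP => _ /=; first by rewrite add1n subSS exprS; ring.
by rewrite add0n subSn // exprS; ring.
Qed.

Lemma normr_digit_prod (R : realType) (p q : R) n k :
  `|digit_prod p q n k| = digit_prod `|p| `|q| n k.
Proof. by rewrite !digit_prodE normrM !normrX. Qed.

Lemma digit_prodX (R : realType) (p q : R) m n k :
  digit_prod (p ^+ m) (q ^+ m) n k = digit_prod p q n k ^+ m.
Proof. by rewrite !digit_prodE exprMn -!exprM mulnC [(m * ones _ _)%N]mulnC. Qed.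

Lemma digit_prod_ge0 (R : realType) (p q : R) n k :
  0 <= p -> 0 <= q -> 0 <= digit_prod p q n k.
Proof. by move=> p0 q0; rewrite digit_prodE mulr_ge0 // exprn_ge0. Qed.

Lemma le_digit_prod (R : realType) (p q q' : R) n k :
  0 <= p -> 0 <= q -> q <= q' -> digit_prod p q n k <= digit_prod p q' n k.
Proof.
move=> p0 q0 qq'; rewrite !digit_prodE ler_wpM2l ?exprn_ge0 //.
by rewrite lerXn2r // nnegrE (le_trans q0).
Qed.

(** With at most n/3 factors q, each of them can be grouped with two factors p,
and the remaining factors p are at least 1. *)
Lemma digit_prod_ge1 (R : realType) (p q : R) n k :
  1 <= p -> 0 <= q -> 1 <= p ^+ 2 * q -> (3 * ones n k <= n)%N ->
  1 <= digit_prod p q n k.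
Proof.
move=> p1 q0 ppq le_n; rewrite digit_prodE.
apply: (@le_trans _ _ ((p ^+ 2 * q) ^+ ones n k)); first by apply: exprn_ege1.
rewrite exprMn -exprM ler_wpM2r ?exprn_ge0 //; apply: ler_weXn2l => //.
by have := ones_le n k; lia.
Qed.

Lemma ones_first_digit m d k : (k < 3 ^ m)%N ->
  (d < 3)%N -> ones m.+1 (d * 3 ^ m + k) = ((d == 1%N) + ones m k)%N.
Proof.
elim: m k => [|m IHm] k.
  by rewrite expn0 ltnS leqn0 => /eqP -> d3 /=; rewrite muln1 !addn0 modn_small.
rewrite expnS => km d3.
have -> : (d * (3 * 3 ^ m) + k)%N = ((d * 3 ^ m + k %/ 3) * 3 + k %% 3)%N.
  by rewrite {1}(divn_eq k 3); ring.
have divE : (((d * 3 ^ m + k %/ 3) * 3 + k %% 3) %/ 3 = d * 3 ^ m + k %/ 3)%N.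
  by rewrite divnMDl // [X in (_ + X)%N]divn_small ?addn0 // ltn_pmod.
rewrite /ones -/ones -/(ones m.+1 _) divE modnMDl modn_mod.
rewrite IHm //; last by rewrite ltn_divLR // mulnC.
by rewrite addnCA.
Qed.

(** * The centred walk exceeds every level *)

(** The walk driven by the digits of k, most significant first, goes up by 1 on a
digit 0 or 2 and down by 2 on a digit 1; [survives n l k] says that during its
first n steps it stays below level l. *)
Fixpoint survives (n l k : nat) : bool :=
  (0 < l)%N &&
  if n is m.+1 then
    survives m (if (k %/ 3 ^ m)%N == 1%N then l.+2 else l.-1) (k %% 3 ^ m)%N
  else true.

(** The probability that the walk stays below level l during n steps, computed by
conditioning on the first step. *)
Fixpoint survival (R : realType) (n l : nat) : R :=
  if l is l'.+1 then
    if n is m.+1 then (2 * survival R m l' + survival R m l'.+3) / 3 else 1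
  else 0.

Lemma sum_survives (R : realType) n l :
  \sum_(0 <= k < 3 ^ n) (survives n l k)%:R = 3 ^+ n * survival R n l.
Proof.
elim: n l => [|n IHn] [|l].
- by rewrite big_nat1 mulr0.
- by rewrite big_nat1 mulr1.
- by rewrite big1 ?mulr0.
rewrite sum_first_digit.
have -> : 3 ^+ n.+1 * survival R n.+1 l.+1 =
    3 ^+ n * survival R n l + 3 ^+ n * survival R n l.+3 +
    3 ^+ n * survival R n l.
  by rewrite /= exprS; field.
rewrite -!IHn -!big_split /=; apply: eq_big_nat => k /andP[_ lt_k].
have p3 : (0 < 3 ^ n)%N by rewrite expn_gt0.
rewrite divn_small // modn_small // divnDr // divnn p3 divn_small // add0n eqxx.
rewrite modnDr modn_small // [(k + 2 * _)%N]addnC divnMDl // divn_small // addn0.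
by rewrite /= modnMDl modn_small.
Qed.

Lemma survival_itv (R : realType) n l : 0 <= survival R n l <= 1.
Proof.
elim: n l => [|n IHn] [|l] /=; rewrite ?lexx ?ler01 //.
by have := IHn l; have := IHn l.+3; lra.
Qed.

Lemma survival_decr (R : realType) n l : survival R n.+1 l <= survival R n l.
Proof.
elim: n l => [|n IHn] [|l] //.
  by case/andP: (survival_itv R 1 l.+1).
have /= h1 := IHn l; have /= h2 := IHn l.+3; rewrite [leLHS]/= [leRHS]/=.
by move: h1 h2; rewrite /=; lra.
Qed.

Lemma bounded_multiples_eq0 (R : realType) (x C : R) :
  (forall l : nat, l%:R * `|x| <= C) -> x = 0.
Proof.
move=> bnd; apply/eqP; apply: contraT => x0.
have xp : 0 < `|x| by rewrite normr_gt0.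
have := bnd (Num.bound (C / `|x|)); rewrite leNgt => /negP[].
rewrite -ltr_pdivrMr //; apply: le_lt_trans (archi_boundP _).
  by [].
by rewrite divr_ge0 // (le_trans _ (bnd 0%N)) // mul0r.
Qed.

(** The characteristic polynomial X^3 - 3X + 2 = (X - 1)^2 (X + 2) leaves the
solutions 1, l and (-2)^l. The second difference of a solution is a multiple of
(-2)^l, so boundedness kills it; then d is affine, and boundedness kills its
slope. *)
Lemma bounded_harmonic_eq0 (R : realType) (d : nat -> R) :
  (forall l, 0 <= d l <= 1) -> d 0%N = 0 ->
  (forall l, 3 * d l.+1 = 2 * d l + d l.+3) -> forall l, d l = 0.
Proof.
move=> d01 d0 dE.
pose e l := d l.+1 - d l; pose g l := e l.+1 - e l.
have gE l : g l = (-2) ^+ l * g 0%N.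
  elim: l => [|l IHl]; first by rewrite expr0 mul1r.
  rewrite exprS -mulrA -IHl /g /e; have := dE l; lra.
have g0 : g 0%N = 0.
  apply: (@bounded_multiples_eq0 _ _ 4) => l.
  apply: (@le_trans _ _ `|g l|).
    rewrite (gE l) normrM normrX normrN (ger0_norm (ler0n R 2)).
    by rewrite -natrX ler_wpM2r // ler_nat ltnW // ltn_expl.
  rewrite /g /e ler_norml; have := d01 l; have := d01 l.+1; have := d01 l.+2.
  lra.
have eE l : e l = e 0%N.
  by elim: l => // l <-; apply/eqP; rewrite -subr_eq0 -/(g l) gE g0 mulr0.
have dlE l : d l = l%:R * e 0%N.
  elim: l => [|l IHl]; first by rewrite mul0r.
  by rewrite -natr1 mulrDl -IHl mul1r; move: (eE l); rewrite /e; lra.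
have e0 : e 0%N = 0.
  apply: (@bounded_multiples_eq0 _ _ 1) => l.
  rewrite -[l%:R]ger0_norm // -normrM -dlE ger0_norm; by case/andP: (d01 l).
by move=> l; rewrite dlE e0 mulr0.
Qed.

(** The limit in n is a function of l to which [bounded_harmonic_eq0] applies:
pass to the limit in the recursion. *)
Lemma survival_cvg0 (R : realType) l : survival R n l @[n --> \oo] --> 0.
Proof.
pose d l : R := limn (survival R ^~ l).
have cvgd j : survival R n j @[n --> \oo] --> d j.
  apply: nonincreasing_is_cvgn.
    by apply/nonincreasing_seqP => n; exact: survival_decr.
  by exists 0 => _ [n _ <-]; case/andP: (survival_itv R n j).
rewrite -(@bounded_harmonic_eq0 R d _ _ _ l) //.
- move=> j; apply/andP; split.
    by apply: limr_ge; [exact: cvgd|near=> n; case/andP: (survival_itv R n j)].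
  by apply: limr_le; [exact: cvgd|near=> n; case/andP: (survival_itv R n j)].
- apply: lim_near_cst => //; apply: nearW => n.
  by case: n.
- move=> j.
  have h1 : 3 * survival R n.+1 j.+1 @[n --> \oo] --> 3 * d j.+1.
    by apply: cvgMl_tmp; rewrite (cvg_shiftS (survival R ^~ j.+1)); exact: cvgd.
  have h2 : 3 * survival R n.+1 j.+1 @[n --> \oo] --> 2 * d j + d j.+3.
    have -> : (fun n => 3 * survival R n.+1 j.+1) =
              (fun n => 2 * survival R n j + survival R n j.+3).
      by apply/funext => n /=; field.
    by apply: cvgD; [apply: cvgMl_tmp; exact: cvgd | exact: cvgd].
  exact: (cvg_unique _ h1 h2).
Unshelve. all: end_near.
Qed.

(** Links the two readings of the digits: the walk of [survives] reads k from its
most significant digit, while the first m digits of k form the number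
k %/ 3 ^ (n - m). *)
Lemma survives_prefix n l k : (k < 3 ^ n)%N ->
  (forall m, (m <= n)%N -> (m < 3 * ones m (k %/ 3 ^ (n - m)) + l)%N) ->
  survives n l k.
Proof.
elim: n l k => [|n IHn] l k lt_k low.
  by have := low 0%N (leqnn _); rewrite /= muln0 add0n => ->.
have p3 : (0 < 3 ^ n)%N by rewrite expn_gt0.
have l0 : (0 < l)%N by have := low 0%N isT; rewrite /= muln0 add0n.
rewrite /= l0 /=; apply: IHn; first by rewrite ltn_pmod.
move=> m le_mn; have := low m.+1 le_mn.
have d3 : (k %/ 3 ^ n < 3)%N by rewrite ltn_divLR // -expnS.
have nE : (3 ^ n = 3 ^ m * 3 ^ (n - m))%N by rewrite -expnD subnKC.
have q3 : (0 < 3 ^ (n - m))%N by rewrite expn_gt0.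
have -> : (k %/ 3 ^ (n.+1 - m.+1) =
    k %/ 3 ^ n * 3 ^ m + (k %% 3 ^ n) %/ 3 ^ (n - m))%N.
  by rewrite subSS {1}(divn_eq k (3 ^ n)) {2}nE mulnA divnMDl.
rewrite ones_first_digit //; last by rewrite ltn_divLR // -nE ltn_pmod.
case: eqP => _ /=; lia.
Qed.

(** * Null sets given by covers by cells *)

(** For c = 1 the selected cells are enlarged by their neighbours, so that a point
outside this set has no selected cell next to its own. *)
Definition fat_cells {R : realType} (c : R) (n : nat) (b : nat -> bool) : set R :=
  \bigcup_(k < 3 ^ n)
    (if b k then [set` `[(k%:R - c) / 3 ^+ n, (k%:R + 1 + c) / 3 ^+ n]]
     else set0).

Lemma mem_fat_cells (R : realType) (c : R) n (b : nat -> bool) k (x : R) :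
  (k < 3 ^ n)%N -> b k -> k%:R - c <= x * 3 ^+ n <= k%:R + 1 + c ->
  fat_cells c n b x.
Proof.
move=> lt_k bk xk; exists k => //=.
by rewrite bk /= in_itv /= ler_pdivrMr ?ler_pdivlMr ?exprn_gt0.
Qed.

Lemma measurable_fat_cells (R : realType) (c : R) n (b : nat -> bool) :
  measurable (fat_cells c n b).
Proof. by apply: bigcup_measurable => k _; case: ifP. Qed.

Lemma measure_fat_cells (R : realType) (c : R) n (b : nat -> bool) : 0 <= c ->
  (lebesgue_measure (fat_cells c n b) <=
    ((1 + 2 * c) * (\sum_(0 <= k < 3 ^ n) (b k)%:R) / 3 ^+ n)%:E)%E.
Proof.
move=> c0.
have e3 : (0 : R) < 3 ^+ n by rewrite exprn_gt0.
rewrite /fat_cells bigcup_mkord; pose A k : set R := if b k then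
  [set` `[(k%:R - c) / 3 ^+ n, (k%:R + 1 + c) / 3 ^+ n]] else set0.
rewrite -/(A _).
apply: (@le_trans _ _ (\sum_(k < 3 ^ n) lebesgue_measure (A k))%E).
  by apply: Boole_inequality => k _; rewrite /A; case: ifP.
rewrite big_mkord mulr_sumr mulr_suml -sumEFin; apply: lee_sum => k _.
rewrite /A; case: (b k); last by rewrite measure0 mulr0 mul0r.
rewrite lebesgue_measure_itv /= lte_fin ltr_pM2r ?invr_gt0 //.
case: ifP => _; last by rewrite lee_fin divr_ge0 ?ltW // mulr1; lra.
by rewrite -EFinB lee_fin -mulrBl ler_pM2r ?invr_gt0 //; lra.
Qed.

Lemma negligible_approx (R : realType) (A : set R) (U : nat -> set R)
    (e : nat -> R) :
  (forall n, measurable (U n)) -> (forall n, A `<=` U n) ->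
  (forall n, (lebesgue_measure (U n) <= (e n)%:E)%E) ->
  e n @[n --> \oo] --> 0 -> lebesgue_measure.-negligible A.
Proof.
move=> mU AU Ue e0; exists (\bigcap_n U n); split.
- exact: bigcapT_measurable.
- apply/eqP; rewrite eq_le measure_ge0 andbT; apply/lee_addgt0Pr => d d0.
  rewrite add0e.
  have : \forall n \near \oo, e n <= d.
    by near=> n; apply: ltW; near: n; apply: (cvgr_lt 0).
  case=> N _ /(_ N (leqnn N)) /= eN.
  apply: (@le_trans _ _ (lebesgue_measure (U N))).
    apply: le_measure; rewrite ?inE; [exact: bigcapT_measurable|exact: mU|].
    exact: bigcap_inf.
  by apply: le_trans (Ue N) _; rewrite lee_fin.
- by move=> x Ax n _; exact: AU.
Unshelve. all: end_near.
Qed.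

Definition cell {R : realType} (n : nat) (x : R) : nat := Num.truncn (x * 3 ^+ n).

Lemma cell_itv (R : realType) n (x : R) : 0 <= x ->
  (cell n x)%:R <= x * 3 ^+ n < (cell n x)%:R + 1.
Proof.
by move=> x0; rewrite natr1 /cell truncn_itv // mulr_ge0 // exprn_ge0.
Qed.

Lemma cell_lt (R : realType) n (x : R) : 0 <= x -> x < 1 -> (cell n x < 3 ^ n)%N.
Proof.
move=> x0 x1; have /andP[h _] := cell_itv _ n _ x0.
by rewrite -(ltr_nat R) natrX (le_lt_trans h) // gtr_pMl // exprn_gt0.
Qed.

Lemma cellS (R : realType) n (x : R) : 0 <= x -> (cell n.+1 x %/ 3)%N = cell n x.
Proof.
move=> x0; have /andP[h1 h2] := cell_itv _ n.+1 _ x0.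
apply/esym/truncn_def; move: (cell _ _) h1 h2 => k h1 h2.
have h3 : (k %/ 3 * 3)%:R <= k%:R :> R by rewrite ler_nat leq_divM.
have h4 : k%:R + 1 <= ((k %/ 3).+1 * 3)%:R :> R.
  by rewrite natr1 ler_nat ltn_ceil.
by move: h1 h2 h3 h4; rewrite exprS mulrCA !natrM; set y := x * _; lra.
Qed.

Lemma cell_prefix (R : realType) n m (x : R) : 0 <= x -> (m <= n)%N ->
  (cell n x %/ 3 ^ (n - m))%N = cell m x.
Proof.
move=> x0 /subnKC <-; elim: (n - m)%N => [|j IHj]; first by rewrite addn0 subnn divn1.
by rewrite addnS subSn ?leq_addr // expnS divnMA cellS.
Qed.

(** If the walk is eventually negative then it stays below some level l. For fixed
l the points whose walk stays below l are covered, at each order n, by cells of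
total length [survival R n l], which tends to 0. *)
Lemma negligible_low_walk (R : realType) :
  lebesgue_measure.-negligible
    [set x : R | (0 <= x < 1) /\
      exists N, forall n, (N <= n)%N -> (n < 3 * ones n (cell n x))%N].
Proof.
pose Z l : set R := [set x : R | (0 <= x < 1) /\
  forall n, (n < 3 * ones n (cell n x) + l)%N].
suff : lebesgue_measure.-negligible (\bigcup_l Z l).
  apply: negligibleS => x [x01 [N low]]; exists N.+1 => //; split => // n.
  by case: (leqP N n) => [/low|]; lia.
apply: negligible_bigcup => l.
apply: (@negligible_approx _ _ (fun n => fat_cells 0 n (survives n l))
  (survival R ^~ l)).
- by move=> n; exact: measurable_fat_cells.
- move=> n x [/andP[x0 x1] low]; have /andP[h1 h2] := cell_itv _ n _ x0.
  apply: (@mem_fat_cells _ _ _ _ (cell n x)); first exact: cell_lt.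
    by apply: survives_prefix => [|m mn]; [exact: cell_lt|rewrite cell_prefix].
  by rewrite subr0 addr0 h1 ltW.
- move=> n; apply: le_trans (measure_fat_cells _ _ _ _ _) _ => //.
  rewrite sum_survives lee_fin mulr0 addr0 mul1r mulrAC.
  by rewrite divff ?expf_neq0 // mul1r.
- exact: survival_cvg0.
Qed.

(** * Cells of large slope *)

(** With P = ln p and Q = ln q, the derivative at t = 0 of
(2 exp(tP) + exp(tQ)) / 3 is (2P + Q) / 3 < 0, and t = 1/m for large m is small
enough. *)
Lemma subunit_sum_of_roots (R : realType) (p q : R) : 0 < p -> 0 < q ->
  p ^+ 2 * q < 1 ->
  exists (m : nat) (r s : R), [/\ (0 < m)%N, 0 < r, 0 < s &
    [/\ r ^+ m = p, s ^+ m = q & 2 * r + s < 3]].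
Proof.
move=> p0 q0 ppq1.
have expR_le (x : R) : x < 1 -> expR x <= (1 - x)^-1.
  move=> x1; have x1' : 0 < 1 - x by rewrite subr_gt0.
  rewrite -[expR x]invrK -expRN lef_pV2 ?posrE ?expR_gt0 //.
  by have := expR_ge1Dx (- x).
pose P := ln p; pose Q := ln q.
have PQ : 2 * P + Q < 0.
  have : ln (p ^+ 2 * q) < 0 by apply: ln_lt0; rewrite ppq1 mulr_gt0 ?exprn_gt0.
  by rewrite lnM ?posrE ?exprn_gt0 // lnXn // mulr2n /P /Q; lra.
pose d := - (2 * P + Q).
have d0 : 0 < d by rewrite oppr_gt0.
(* After the bound exp(x) <= 1 / (1 - x), the claim becomes - 3PQ < d m together
with P < m and Q < m. *)
pose m := (Num.bound (`|P| + `|Q| + 3 * `|P| * `|Q| / d)).+1.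
pose M : R := m%:R.
have M0 : 0 < M by rewrite ltr0n.
have hM : `|P| + `|Q| + 3 * `|P| * `|Q| / d < M.
  apply: (@lt_trans _ _ (Num.bound (`|P| + `|Q| + 3 * `|P| * `|Q| / d))%:R).
    by apply: archi_boundP; rewrite !addr_ge0 ?divr_ge0 ?mulr_ge0 // ltW.
  by rewrite ltr_nat.
have P_0 : 0 <= `|P| by [].
have Q_0 : 0 <= `|Q| by [].
have PQd : 0 <= 3 * `|P| * `|Q| / d by rewrite divr_ge0 ?mulr_ge0 // ltW.
have PM : P < M by have := ler_norm P; lra.
have QM : Q < M by have := ler_norm Q; lra.
have PQM : - (3 * (P * Q)) < d * M.
  have : 3 * `|P| * `|Q| / d < M by lra.
  rewrite ltr_pdivrMr // [M * d]mulrC; apply: le_lt_trans.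
  rewrite -mulrA -normrM; have := ler_norm (- (P * Q)); rewrite normrN; lra.
exists m, (expR (P / M)), (expR (Q / M)); split; rewrite ?expR_gt0 //.
split.
- by rewrite -expRM_natr divfK ?gt_eqF // lnK.
- by rewrite -expRM_natr divfK ?gt_eqF // lnK.
have hP := expR_le (P / M); have hQ := expR_le (Q / M).
have {}hP : expR (P / M) <= M / (M - P).
  have -> : M / (M - P) = (1 - P / M)^-1.
    by field; rewrite !gt_eqF ?subr_gt0.
  by apply: hP; rewrite ltr_pdivrMr // mul1r.
have {}hQ : expR (Q / M) <= M / (M - Q).
  have -> : M / (M - Q) = (1 - Q / M)^-1.
    by field; rewrite !gt_eqF ?subr_gt0.
  by apply: hQ; rewrite ltr_pdivrMr // mul1r.
apply: (@le_lt_trans _ _ (2 * (M / (M - P)) + M / (M - Q))); first lra.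
have MP : 0 < M - P by rewrite subr_gt0.
have MQ : 0 < M - Q by rewrite subr_gt0.
rewrite mulrA addf_div ?gt_eqF // ltr_pdivrMr ?mulr_gt0 // -subr_gt0.
have -> : 3 * ((M - P) * (M - Q)) - (2 * M * (M - Q) + M * (M - P)) =
  d * M + 3 * (P * Q) by rewrite /d; ring.
by lra.
Qed.

Lemma sum_geometric_lty (R : realType) (a z : R) (u : (\bar R)^nat) :
  0 <= a -> 0 < z < 1 -> (forall n, 0 <= u n)%E ->
  (forall n, u n <= (a * z ^+ n)%:E)%E -> (\sum_(0 <= n <oo) u n < +oo)%E.
Proof.
move=> a0 /andP[z0 z1] u0 uz.
apply: (@le_lt_trans _ _ (a * (1 - z)^-1)%:E); last exact: ltry.
apply: lime_le; first by apply: is_cvg_nneseries.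
apply: nearW => n.
apply: (@le_trans _ _ (\sum_(0 <= k < n) (a * z ^+ k)%:E)%E); first exact: lee_sum.
rewrite sumEFin lee_fin.
by apply: geometric_le_lim => //; rewrite ger0_norm ?ltW.
Qed.

(** Exponential Markov inequality and Borel-Cantelli. If p = a^m, q <= b^m and
rho = (2a + b) / 3 < 1, take s = sqrt rho and r = s^m: a cell with product above
r^n has digit_prod a b n k > s^n, and the proportion of such cells is at most
rho^n / s^n = s^n. *)
Lemma negligible_heavy_cells (R : realType) (p q : R) : 0 < p -> 0 <= q ->
  p ^+ 2 * q < 1 ->
  exists2 r : R, 0 < r < 1 &
    lebesgue_measure.-negligible (lim_sup_set
      (fun n => fat_cells (1 : R) n (fun k => r ^+ n < digit_prod p q n k))).
Proof.
move=> p0 q0 ppq1.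
have pp0 : 0 < p ^+ 2 by rewrite exprn_gt0.
(* A slight increase of q makes it positive, which covers the case q = 0. *)
have [q' qq' ppq'1] : exists2 q', q < q' & p ^+ 2 * q' < 1.
  exists ((q + (p ^+ 2)^-1) / 2).
    have : q < (p ^+ 2)^-1 by rewrite -[ltRHS]mul1r ltr_pdivlMr // mulrC.
    by lra.
  by rewrite mulrA mulrDr divff ?gt_eqF //; lra.
have q'0 : 0 < q' by exact: le_lt_trans qq'.
have [m [a [b [m0 a0 b0 [amp bmq ab3]]]]] :=
  subunit_sum_of_roots _ _ _ p0 q'0 ppq'1.
pose rho := (2 * a + b) / 3; pose s := Num.sqrt rho.
have rho0 : 0 < rho by rewrite /rho; lra.
have s0 : 0 < s by rewrite sqrtr_gt0.
have s1 : s < 1 by rewrite -sqrtr1 ltr_sqrt // /rho; lra.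
have ssE : s * s = rho by rewrite -expr2 sqr_sqrtr // ltW.
exists (s ^+ m); first by rewrite exprn_gt0 // exprn_ilt1 ?ltW // -lt0n.
apply/negligibleP.
  apply: bigcapT_measurable => n; apply: bigcup_measurable => k _.
  exact: measurable_fat_cells.
apply: lim_sup_set_cvg0; first by move=> n; exact: measurable_fat_cells.
apply: (@sum_geometric_lty _ 3 s) => //; first by rewrite s0 s1.
move=> n; apply: le_trans (measure_fat_cells _ _ _ _ _) _ => //.
rewrite lee_fin.
have e3 : (0 : R) < 3 ^+ n by rewrite exprn_gt0.
have sn0 : 0 < s ^+ n by rewrite exprn_gt0.
rewrite ler_pdivrMr // -mulrA (_ : 1 + 2 * 1 = 3 :> R) ?ler_pM2l //; last by ring.
have -> : s ^+ n * 3 ^+ n = (2 * a + b) ^+ n / s ^+ n.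
  have -> : 2 * a + b = s * s * 3 by rewrite ssE /rho; field.
  by rewrite !exprMn mulrAC mulfK ?gt_eqF // mulrC.
rewrite -sum_digit_prod mulr_suml; apply: ler_sum => k _.
case: ltP => [heavy|_] /=; last by rewrite divr_ge0 ?digit_prod_ge0 // ltW.
rewrite ler_pdivlMr // mul1r ltW //.
rewrite -(ltr_pXn2r m0) ?nnegrE ?digit_prod_ge0 // ?ltW //.
rewrite -digit_prodX amp bmq -exprM mulnC exprM.
by apply: lt_le_trans heavy _; apply: le_digit_prod; rewrite // ltW.
Qed.

(** * Values and increments of the limit function *)

Lemma okamoto_step (R : realType) (a : R) f n k :
  okamoto_approximants a f -> (k <= 3 ^ n)%N ->
  f n.+1 (triadic n k) = f n (triadic n k).
Proof.
move=> H; rewrite leq_eqVlt => /orP[/eqP ->|]; last exact: (okamoto_left H).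
have p3 : (0 < 3 ^ n)%N by rewrite expn_gt0.
by rewrite -(prednK p3); apply: (okamoto_right H); rewrite prednK.
Qed.

Lemma triadic_refine (R : realType) n j k :
  triadic (n + j) (3 ^ j * k) = triadic n k :> R.
Proof.
elim: j => [|j IHj]; first by rewrite addn0 expn0 mul1n.
by rewrite addnS expnS -mulnA triadicS.
Qed.

Lemma okamoto_node (R : realType) (a : R) f n j k :
  okamoto_approximants a f -> (k <= 3 ^ n)%N ->
  f (n + j)%N (triadic n k) = f n (triadic n k).
Proof.
move=> H le_k; elim: j => [|j IHj]; first by rewrite addn0.
rewrite -IHj addnS -(triadic_refine _ n j k); apply: (okamoto_step _ _ _ _ _ H).
by rewrite expnD mulnC leq_mul2r le_k orbT.
Qed.

Lemma limit_fun_node (R : realType) (a : R) f n k :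
  okamoto_approximants a f -> (k <= 3 ^ n)%N ->
  limit_fun f (triadic n k) = f n (triadic n k).
Proof.
move=> H le_k; apply: lim_near_cst => //; near=> m.
have /subnKC <- : (n <= m)%N by near: m; exact: nbhs_infty_ge.
exact: (okamoto_node _ _ _ _ _ _ H).
Unshelve. all: end_near.
Qed.

(** The recursive definition of the approximants, in terms of the last ternary
digit of the index of a cell. *)
Lemma okamoto_subcell (R : realType) (a : R) f n k :
  okamoto_approximants a f -> (k < 3 ^ n.+1)%N ->
  let l := f n (triadic n (k %/ 3)) in
  let d := f n (triadic n (k %/ 3).+1) - l in
  f n.+1 (triadic n.+1 k) =
    l + (if (k %% 3)%N == 0%N then 0 else if (k %% 3)%N == 1%N then a
         else 1 - a) * d /\
  f n.+1 (triadic n.+1 k.+1) - f n.+1 (triadic n.+1 k) =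
    d * (if (k %% 3)%N == 1%N then 1 - 2 * a else a).
Proof.
move=> H lt_k l d.
have lt_q : (k %/ 3 < 3 ^ n)%N by rewrite ltn_divLR // mulnC -expnS.
have e0 : f n.+1 (triadic n.+1 (3 * (k %/ 3))) = l.
  by rewrite triadicS; apply: (okamoto_step _ _ _ _ _ H); exact: ltnW.
have e3 : f n.+1 (triadic n.+1 (3 * (k %/ 3).+1)) = l + d.
  by rewrite triadicS (okamoto_step _ _ _ _ _ H) // /d addrC subrK.
have e1 := okamoto_third H lt_q; have e2 := okamoto_two_thirds H lt_q.
rewrite -/l -/d in e1 e2.
have := divn_eq k 3; have := ltn_pmod k (isT : (0 < 3)%N).
case: (k %% 3)%N => [|[|[|//]]] _ kE; split => /=.
- by rewrite {1}kE mulnC addn0 e0 mul0r addr0.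
- have -> : k.+1 = (3 * (k %/ 3) + 1)%N by lia.
  have -> : triadic n.+1 k = triadic n.+1 (3 * (k %/ 3)) :> R by congr triadic; lia.
  by rewrite e0 e1; ring.
- by rewrite {1}kE mulnC e1.
- have -> : k.+1 = (3 * (k %/ 3) + 2)%N by lia.
  have -> : triadic n.+1 k = triadic n.+1 (3 * (k %/ 3) + 1) :> R by congr triadic; lia.
  by rewrite e1 e2; ring.
- by rewrite {1}kE mulnC e2.
- have -> : k.+1 = (3 * (k %/ 3).+1)%N by lia.
  have -> : triadic n.+1 k = triadic n.+1 (3 * (k %/ 3) + 2) :> R by congr triadic; lia.
  by rewrite e2 e3; ring.
Qed.

Lemma okamoto_increment (R : realType) (a : R) f n k :
  okamoto_approximants a f -> (k < 3 ^ n)%N ->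
  f n (triadic n k.+1) - f n (triadic n k) = digit_prod a (1 - 2 * a) n k.
Proof.
move=> H; elim: n k => [|n IHn] k lt_k.
  move: lt_k; rewrite expn0 ltnS leqn0 => /eqP ->.
  by rewrite triadic0 (triadic1 R 0) !(okamoto0 H) ?subr0 // in_itv /= ?lexx ?ler01.
have [_ ->] := okamoto_subcell _ _ _ _ _ H lt_k.
by rewrite IHn // ltn_divLR // mulnC -expnS.
Qed.

(** On a cell, all later approximants take values between the two values at the
ends of the cell, because refining the cell only inserts convex combinations of
these values. *)
Lemma okamoto_between (R : realType) (a : R) f n j k x :
  0 < a < 1 -> okamoto_approximants a f -> (k < 3 ^ n)%N ->
  x \in `[triadic n k, triadic n k.+1] ->
  exists2 t : R, 0 <= t <= 1 &
    f (n + j)%N x = f n (triadic n k) + t * digit_prod a (1 - 2 * a) n k.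
Proof.
move=> /andP[a0 a1] H; elim: j n k => [|j IHj] n k lt_k xk.
  have e3 : (0 : R) < 3 ^+ n by rewrite exprn_gt0.
  have [c [d fE]] := okamoto_affine H lt_k.
  have uv : triadic n k <= triadic n k.+1 :> R by rewrite ler_triadic.
  exists (x * 3 ^+ n - k%:R).
    move: xk; rewrite in_itv /= /triadic ler_pdivrMr // ler_pdivlMr // -natr1.
    by move=> /andP[]; lra.
  rewrite addn0 -(okamoto_increment _ _ _ _ _ H lt_k) !fE //.
  - by rewrite /triadic -natr1; field; rewrite gt_eqF.
  - by rewrite in_itv /= lexx uv.
  - by rewrite in_itv /= lexx uv.
have [K lt_K [xK KE]] : exists2 K, (K < 3 ^ n.+1)%N &
    x \in `[(triadic n.+1 K : R), triadic n.+1 K.+1] /\ (K %/ 3 = k)%N.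
  have u0 : triadic n.+1 (3 * k) = triadic n k :> R by rewrite triadicS.
  have u3 : triadic n.+1 (3 * k).+3 = triadic n k.+1 :> R.
    by rewrite -[RHS]triadicS; congr triadic; lia.
  move: xk; rewrite -u0 -u3 in_itv /= => /andP[x0 x3].
  have lt3 : ((3 * k).+2 < 3 ^ n.+1)%N by rewrite expnS; lia.
  case: (leP x (triadic n.+1 (3 * k).+1)) => x1.
    by exists (3 * k)%N; [lia|split; [rewrite in_itv /= x0 x1|lia]].
  case: (leP x (triadic n.+1 (3 * k).+2)) => x2.
    by exists (3 * k).+1; [lia|split; [rewrite in_itv /= x2 ltW|lia]].
  by exists (3 * k).+2; [lia|split; [rewrite in_itv /= x3 ltW|lia]].
have [t t01 ->] : exists2 t : R, 0 <= t <= 1 & f (n + j.+1)%N x =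
    f n.+1 (triadic n.+1 K) + t * digit_prod a (1 - 2 * a) n.+1 K.
  by rewrite addnS -addSn; exact: IHj.
have [-> _] := okamoto_subcell _ _ _ _ _ H lt_K.
move s_def: (if _ then _ else _) => s.
rewrite KE (okamoto_increment _ _ _ _ _ H lt_k) /= KE.
exists (s + t * (if (K %% 3)%N == 1%N then 1 - 2 * a else a)); last first.
  by move: (if _ then _ else _) => w; ring.
rewrite -s_def; have := ltn_pmod K (isT : (0 < 3)%N).
by case: (K %% 3)%N => [|[|[|//]]] _ /=; nra.
Qed.

Lemma digit_prod_small (R : realType) (a e : R) : 0 < a < 1 -> 0 < e ->
  exists n, forall k, `|digit_prod a (1 - 2 * a) n k| < e.
Proof.
move=> /andP[a0 a1] e0; pose c := Num.max a `|1 - 2 * a|.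
have c0 : 0 <= c by rewrite le_max ltW.
have c1 : c < 1 by rewrite gt_max a1 /= ltr_norml; lra.
have : \forall n \near \oo, c ^+ n < e.
  by apply: (cvgr_lt 0) => //; apply: cvg_expr; rewrite ger0_norm.
case=> n _ /(_ n (leqnn n)) /= cn; exists n => k.
apply: le_lt_trans cn; rewrite normr_digit_prod digit_prodE.
have -> : c ^+ n = c ^+ (n - ones n k) * c ^+ ones n k.
  by rewrite -exprD subnK // ones_le.
have ac : `|a| <= c by rewrite le_max ger0_norm ?lexx // ltW.
have bc : `|1 - 2 * a| <= c by rewrite le_max lexx orbT.
by apply: ler_pM; rewrite ?exprn_ge0 // lerXn2r ?nnegrE.
Qed.

(** The approximants of order at least n differ at x by at most the increment over
a cell of order n, hence form a Cauchy sequence. *)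
Lemma limit_fun_cvg (R : realType) (a : R) f x :
  0 < a < 1 -> okamoto_approximants a f -> x \in `[0, 1] ->
  f n x @[n --> \oo] --> limit_fun f x.
Proof.
move=> a01 H x01; apply/cauchy_cvgP/cauchy_exP => e e0.
have [n small] := digit_prod_small _ _ _ a01 e0.
have [k lt_k xk] := triadic_cover n x01.
exists (f n (triadic n k)); exists n => // m /= /subnKC <-.
have [t /andP[t0 t1] ->] := okamoto_between _ _ _ _ (m - n)%N _ _ a01 H lt_k xk.
rewrite /ball /= opprD addNKr normrN normrM (le_lt_trans _ (small k)) //.
by rewrite ler_piMl // ger0_norm.
Qed.

Lemma oscillation_on_cell (R : realType) (a : R) f n k x y :
  0 < a < 1 -> okamoto_approximants a f -> (k < 3 ^ n)%N ->
  x \in `[triadic n k, triadic n k.+1] -> y \in `[triadic n k, triadic n k.+1] ->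
  `|limit_fun f y - limit_fun f x| <= `|digit_prod a (1 - 2 * a) n k|.
Proof.
move=> a01 H lt_k xk yk.
have sub01 z : z \in `[(triadic n k : R), triadic n k.+1] -> z \in `[0, 1].
  rewrite !in_itv /= => /andP[z0 z1]; apply/andP; split.
    by apply: le_trans z0; rewrite -(triadic0 R n) ler_triadic.
  by apply: (le_trans z1); rewrite -(triadic1 R n) ler_triadic.
have cvg : `|f m y - f m x| @[m --> \oo] --> `|limit_fun f y - limit_fun f x|.
  by apply: cvg_norm; apply: cvgB; apply: (limit_fun_cvg _ _ _ _ a01 H); exact: sub01.
rewrite -(cvg_lim _ cvg) //; apply: limr_le; first by apply: cvgP; exact: cvg.
near=> m; have /subnKC <- : (n <= m)%N by near: m; exact: nbhs_infty_ge.
have [s s01 ->] := okamoto_between _ _ _ _ (m - n)%N _ _ a01 H lt_k xk.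
have [t t01 ->] := okamoto_between _ _ _ _ (m - n)%N _ _ a01 H lt_k yk.
rewrite opprD addrACA subrr add0r -mulrBl normrM ler_piMl //.
by rewrite ler_norml; lra.
Unshelve. all: end_near.
Qed.

Lemma oscillation_on_adjacent_cells (R : realType) (a : R) f n k j x y :
  0 < a < 1 -> okamoto_approximants a f -> (k < 3 ^ n)%N -> (j < 3 ^ n)%N ->
  (k <= j.+1)%N -> (j <= k.+1)%N ->
  x \in `[triadic n k, triadic n k.+1] -> y \in `[triadic n j, triadic n j.+1] ->
  `|limit_fun f y - limit_fun f x| <=
    `|digit_prod a (1 - 2 * a) n k| + `|digit_prod a (1 - 2 * a) n j|.
Proof.
move=> a01 H lt_k lt_j kj jk xk yj.
have adj z i : (i < 3 ^ n)%N -> z \in `[(triadic n i : R), triadic n i.+1] ->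
    forall i', i' = i \/ i' = i.+1 ->
    `|limit_fun f (triadic n i') - limit_fun f z| <=
      `|digit_prod a (1 - 2 * a) n i|.
  move=> lt_i zi i' i'E; apply: (oscillation_on_cell _ _ _ _ _ _ _ a01 H lt_i zi).
  have uv : triadic n i <= triadic n i.+1 :> R by rewrite ler_triadic.
  by case: i'E => ->; rewrite in_itv /= lexx ?andbT.
have [w [wk wj]] : exists w, (w = k \/ w = k.+1) /\ (w = j \/ w = j.+1).
  have [->|[->|->]] : k = j \/ k = j.+1 \/ j = k.+1 by lia.
  - by exists j; split; left.
  - by exists j.+1; split; [left|right].
  - by exists k.+1; split; [right|left].
have := adj _ _ lt_k xk _ wk; have := adj _ _ lt_j yj _ wj.
set W := limit_fun f (triadic n w); rewrite distrC => Wy Wx.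
rewrite -(subrK W (limit_fun f y)) -addrA (le_trans (ler_normD _ _)) //.
by rewrite [leRHS]addrC lerD.
Qed.

(** * Difference quotients along cells *)

Lemma is_derive01P (R : realType) (F : R -> R) (x l : R) :
  is_derive01 F x l <->
  (forall e, 0 < e -> exists2 d, 0 < d & forall y, y \in `[0, 1] ->
     `|y - x| < d -> `|F y - F x - l * (y - x)| <= e * `|y - x|).
Proof.
have quot e y : y != x ->
    (`|l - (F y - F x) / (y - x)| <= e) =
    (`|F y - F x - l * (y - x)| <= e * `|y - x|).
  move=> yx; have yx0 : y - x != 0 by rewrite subr_eq0.
  rewrite -[in RHS](divfK yx0 (F y - F x)) -mulrBl normrM distrC.
  by rewrite ler_pM2r // normr_gt0.
split=> [/cvgrPdist_le dF e e0|dF].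
  have := dF e e0; rewrite near_withinE near_withinE => /nbhs_ballP[d /= d0 dE].
  exists d => // y y01 yd; have [->|yx] := eqVneq y x.
    by rewrite !subrr mulr0 subr0 normr0 mulr0.
  by rewrite -quot //; apply: dE => //; rewrite /ball /= distrC.
apply/cvgrPdist_le => e e0; have [d d0 dE] := dF e e0.
rewrite near_withinE near_withinE; apply/nbhs_ballP; exists d => //= y.
by rewrite /ball /= distrC => yd yx y01; rewrite quot //; apply: dE.
Qed.

Lemma scale_index (R : realType) (d : R) N : 0 < d -> d * 3 ^+ N < 1 ->
  exists n, [/\ (N <= n)%N, d * 3 ^+ n < 1 & 1 <= 3 * d * 3 ^+ n].
Proof.
move=> d0 dN.
have ex : exists m, 1 <= d * 3 ^+ m.
  exists (Num.bound d^-1); rewrite mulrC -ler_pdivrMr // mul1r.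
  apply: ltW; apply: (@lt_trans _ _ (Num.bound d^-1)%:R).
    by apply: archi_boundP; rewrite invr_ge0 ltW.
  by rewrite -natrX ltr_nat ltn_expl.
have [m m1 mmin] := ex_minnP ex.
have lt_Nm : (N < m)%N.
  rewrite ltnNge; apply/negP => le_mN.
  have : d * 3 ^+ m <= d * 3 ^+ N.
    by rewrite ler_pM2l //; apply: ler_weXn2l => //; rewrite ler1n.
  lra.
exists m.-1; split; first by lia.
  rewrite ltNge; apply/negP => /mmin; lia.
by rewrite mulrAC -exprS prednK 1?mulrC //; lia.
Qed.

(** It is enough that, near x, all cells of order n have slope at most r^n: two
points x and y with 3^-(n+1) <= |y - x| < 3^-n lie in equal or adjacent cells,
so F varies between them by at most 2 r^n / 3^n <= 6 r^n |y - x|. *)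
Lemma is_derive01_eq0 (R : realType) (a r : R) f x :
  0 < a < 1 -> okamoto_approximants a f -> x \in `[0, 1] -> 0 < r < 1 ->
  (exists N, forall n, (N <= n)%N -> forall k, (k < 3 ^ n)%N ->
     k%:R - 1 <= x * 3 ^+ n <= k%:R + 1 + 1 ->
     `|digit_prod (3 * a) (3 * (1 - 2 * a)) n k| <= r ^+ n) ->
  is_derive01 (limit_fun f) x 0.
Proof.
move=> a01 H x01 /andP[r0 r1] [N flat]; apply/is_derive01P => e e0.
have : \forall n \near \oo, 6 * r ^+ n < e.
  apply: (cvgr_lt 0) => //; rewrite -[X in _ --> X](mulr0 6).
  by apply: cvgMl_tmp; apply: cvg_expr; rewrite ger0_norm // ltW.
case=> N' _ small; pose M := maxn N N'.
exists (3 ^+ M)^-1; first by rewrite invr_gt0 exprn_gt0.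
move=> y y01; rewrite mul0r subr0.
have [->|yx] := eqVneq y x; first by rewrite !subrr normr0 mulr0.
have d0 : 0 < `|y - x| by rewrite normr_gt0 subr_eq0.
rewrite -[X in _ < X]mul1r ltr_pdivlMr ?exprn_gt0 // => dM.
have [n [le_Mn dn1 dn3]] := scale_index _ _ _ d0 dM.
move: le_Mn; rewrite geq_max => /andP[le_Nn le_N'n].
have e3 : (0 : R) < 3 ^+ n by rewrite exprn_gt0.
have [k lt_k xk] := triadic_cover n x01; have [j lt_j yj] := triadic_cover n y01.
have dn : -1 < y * 3 ^+ n - x * 3 ^+ n < 1.
  by rewrite -mulrBl -ltr_norml normrM (gtr0_norm e3).
have xk' : k%:R <= x * 3 ^+ n <= k%:R + 1.
  by move: xk; rewrite in_itv /= /triadic ler_pdivrMr // ler_pdivlMr // natr1.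
have yj' : j%:R <= y * 3 ^+ n <= j%:R + 1.
  by move: yj; rewrite in_itv /= /triadic ler_pdivrMr // ler_pdivlMr // natr1.
have jk : (j <= k.+1)%N.
  by rewrite -ltnS -(ltr_nat R) -!natr1; lra.
have kj : (k <= j.+1)%N.
  by rewrite -ltnS -(ltr_nat R) -!natr1; lra.
have jk' : j%:R <= k%:R + 1 :> R by rewrite natr1 ler_nat.
have kj' : k%:R <= j%:R + 1 :> R by rewrite natr1 ler_nat.
have flat_cell i : (i < 3 ^ n)%N -> i%:R - 1 <= x * 3 ^+ n <= i%:R + 1 + 1 ->
    `|digit_prod a (1 - 2 * a) n i| <= r ^+ n / 3 ^+ n.
  move=> lt_i xi; rewrite ler_pdivlMr //; apply: le_trans (flat n le_Nn i lt_i xi).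
  rewrite !digit_prodE !exprMn mulrACA -exprD subnK ?ones_le //.
  by rewrite [X in _ <= X]normrM (gtr0_norm e3) mulrC.
have := oscillation_on_adjacent_cells _ _ _ _ _ _ _ _ a01 H lt_k lt_j kj jk xk yj.
move=> /le_trans; apply.
apply: (@le_trans _ _ (2 * r ^+ n / 3 ^+ n)).
  have hk : `|digit_prod a (1 - 2 * a) n k| <= r ^+ n / 3 ^+ n.
    by apply: flat_cell => //; lra.
  have hj : `|digit_prod a (1 - 2 * a) n j| <= r ^+ n / 3 ^+ n.
    by apply: flat_cell => //; lra.
  lra.
rewrite ler_pdivrMr //.
have := small n le_N'n; have rn0 : 0 < r ^+ n by rewrite exprn_gt0.
move=> /= rn; apply: (@le_trans _ _ (2 * r ^+ n * (3 * `|y - x| * 3 ^+ n))).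
  by rewrite ler_peMr // mulr_ge0 // ltW.
have : 0 < `|y - x| * 3 ^+ n by rewrite mulr_gt0.
by nra.
Qed.

(** The slope between two points u <= x <= v is a convex combination of the
difference quotients at x towards u and towards v. *)
Lemma slope_cvg (R : realType) (a l : R) f x :
  okamoto_approximants a f -> 0 <= x < 1 ->
  is_derive01 (limit_fun f) x l -> forall e, 0 < e ->
  exists N, forall n, (N <= n)%N ->
    `|digit_prod (3 * a) (3 * (1 - 2 * a)) n (cell n x) - l| <= e.
Proof.
move=> H /andP[x0 x1] /is_derive01P dF e e0; have [d d0 dE] := dF e e0.
have : \forall n \near \oo, (3^-1 : R) ^+ n < d.
  by apply: (cvgr_lt 0) => //; apply: cvg_expr; rewrite ger0_norm; lra.
case=> N _ small; exists N => n le_Nn; have /= nd := small n le_Nn.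
have e3 : (0 : R) < 3 ^+ n by rewrite exprn_gt0.
have lt_k := cell_lt _ n _ x0 x1; have /andP[ux xv] := cell_itv _ n _ x0.
set k := cell n x in lt_k ux xv *.
set u : R := triadic n k; set v : R := triadic n k.+1.
have vuE : v - u = (3 ^+ n)^-1.
  by rewrite /v /u /triadic -natr1; field; rewrite gt_eqF.
have {}ux : u <= x by rewrite /u /triadic ler_pdivrMr.
have {}xv : x < v by rewrite /v /triadic ltr_pdivlMr //; move: xv; rewrite natr1.
have vud : v - u < d by rewrite vuE -exprVn.
have u01 : u \in `[0, 1].
  rewrite in_itv /=; apply/andP; split; last by lra.
  by rewrite /u -(triadic0 R n) ler_triadic.
have v01 : v \in `[0, 1].
  rewrite in_itv /=; apply/andP; split; first by lra.
  by rewrite /v -(triadic1 R n) ler_triadic.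
have Fu := dE u u01; have Fv := dE v v01.
have {}Fu : `|limit_fun f u - limit_fun f x - l * (u - x)| <= e * (x - u).
  move: Fu; rewrite [`|u - x|]distrC (ger0_norm (_ : 0 <= x - u)) ?subr_ge0 //.
  by apply; lra.
have {}Fv : `|limit_fun f v - limit_fun f x - l * (v - x)| <= e * (v - x).
  by move: Fv; rewrite (ger0_norm (_ : 0 <= v - x)) ?subr_ge0 ?(ltW xv) //; apply; lra.
have Fvu : limit_fun f v - limit_fun f u = digit_prod a (1 - 2 * a) n k.
  rewrite /u /v !(limit_fun_node _ _ _ _ _ H) ?(ltnW lt_k) //.
  exact: (okamoto_increment _ _ _ _ _ H).
have -> : digit_prod (3 * a) (3 * (1 - 2 * a)) n k =
    (limit_fun f v - limit_fun f u) * 3 ^+ n.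
  rewrite Fvu !digit_prodE !exprMn mulrACA -exprD subnK ?ones_le //.
  by rewrite mulrC.
have lE : l = l * (v - u) * 3 ^+ n by rewrite vuE divfK ?gt_eqF.
rewrite [X in _ - X]lE -mulrBl normrM (gtr0_norm e3) -ler_pdivlMr // -vuE.
by move: Fu Fv; rewrite !ler_norml; lra.
Qed.

(** Consecutive slopes s and s' satisfy |s| / 2 <= |s' - s|, since s' / s is 3a or
3(1 - 2a). If both are within 1/8 of their limit then |s| <= 1/2, and
[digit_prod_ge1] then excludes at most n/3 digits 1. *)
Lemma derivable01_low_walk (R : realType) (a : R) f x :
  1 / 2 < a < 1 -> 1 <= (3 * a) ^+ 2 * (3 * (2 * a - 1)) ->
  okamoto_approximants a f -> 0 <= x < 1 -> derivable01 (limit_fun f) x ->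
  exists N, forall n, (N <= n)%N -> (n < 3 * ones n (cell n x))%N.
Proof.
move=> /andP[a2 a1] crit H x01 [l dF].
have [|N slopes] := slope_cvg _ _ _ _ _ H x01 dF (1 / 8); first by lra.
exists N => n le_Nn; rewrite ltnNge; apply/negP => high.
pose s m := digit_prod (3 * a) (3 * (1 - 2 * a)) m (cell m x).
have sn : `|s n - l| <= 1 / 8 by exact: slopes.
have sn1 : `|s n.+1 - l| <= 1 / 8 by apply: slopes; exact: leqW.
have big : 1 <= `|s n|.
  rewrite normr_digit_prod; apply: digit_prod_ge1 => //.
    by rewrite ger0_norm; lra.
  rewrite [`|3 * a|]ger0_norm; last by lra.
  by rewrite [`|3 * (1 - _)|]ler0_norm; [move: crit; lra|lra].
have x0 : 0 <= x by case/andP: x01.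
have sSE : s n.+1 =
    s n * (if (cell n.+1 x %% 3)%N == 1%N then 3 * (1 - 2 * a) else 3 * a).
  by rewrite /s /= cellS.
have : `|s n| / 2 <= `|s n.+1 - s n|.
  rewrite sSE -[X in _ - X]mulr1 -mulrBr normrM ler_pM2l ?(lt_le_trans _ big) //.
  by case: ifP => _; rewrite ler_normr; lra.
have : `|s n.+1 - s n| <= 1 / 4.
  by move: sn sn1; rewrite !ler_norml; lra.
lra.
Qed.

(** * The case a = 1/3 *)

Lemma okamoto_third_id (R : realType) f n k :
  okamoto_approximants (1 / 3 : R) f -> (k <= 3 ^ n)%N ->
  f n (triadic n k) = triadic n k.
Proof.
move=> H; elim: k => [_|k IHk lt_k].
  have := okamoto_node _ _ _ 0%N n 0%N H isT; rewrite add0n !triadic0 => ->.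
  by rewrite (okamoto0 H) // in_itv /= lexx ler01.
have := okamoto_increment _ _ _ _ _ H lt_k; rewrite IHk; last exact: ltnW.
have -> : 1 - 2 * (1 / 3) = 1 / 3 :> R by field.
rewrite digit_prodE -exprD subnK ?ones_le // => /eqP; rewrite subr_eq => /eqP ->.
have e3 : (0 : R) < 3 ^+ n by rewrite exprn_gt0.
by rewrite /triadic -natr1 mul1r exprVn; field; rewrite gt_eqF.
Qed.

Lemma limit_fun_third (R : realType) f (x : R) :
  okamoto_approximants (1 / 3 : R) f -> x \in `[0, 1] -> limit_fun f x = x.
Proof.
move=> H x01; have third01 : 0 < (1 / 3 : R) < 1 by lra.
apply/eqP; rewrite -subr_eq0 -normr_eq0 eq_le normr_ge0 andbT; apply/ler_addgt0Pr => e e0.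
have : \forall n \near \oo, 2 * (3^-1 : R) ^+ n < e.
  apply: (cvgr_lt 0) => //; rewrite -[X in _ --> X](mulr0 2).
  by apply: cvgMl_tmp; apply: cvg_expr; rewrite ger0_norm; lra.
case=> n _ /(_ n (leqnn n)) /= ne.
have e3 : (0 : R) < 3 ^+ n by rewrite exprn_gt0.
have [k lt_k xk] := triadic_cover n x01.
have uk : triadic n k \in `[(triadic n k : R), triadic n k.+1].
  by rewrite in_itv /= lexx ler_triadic.
have := oscillation_on_cell _ _ _ _ _ _ _ third01 H lt_k uk xk.
have -> : 1 - 2 * (1 / 3) = 1 / 3 :> R by field.
rewrite (limit_fun_node _ _ _ _ _ H) ?(ltnW lt_k) // okamoto_third_id ?(ltnW lt_k) //.
rewrite digit_prodE -exprD subnK ?ones_le // mul1r.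
have t0 : 0 < (3^-1 : R) ^+ n by rewrite exprn_gt0.
rewrite (gtr0_norm t0).
have : triadic n k.+1 = triadic n k + 3^-1 ^+ n :> R.
  by rewrite /triadic -natr1 exprVn; field; rewrite gt_eqF.
by move: xk; rewrite in_itv /= !ler_norml add0r; lra.
Qed.

(** * The critical parameter *)

(** The cubic 54b^3 - 27b^2 is increasing on [1/2, 2/3] and passes from 0 to 4. *)
Lemma critical_ratio (R : realType) :
  exists a0 : R, unique (fun b : R => (b \in `]1 / 2, 2 / 3[) /\
    27 * b ^+ 2 - 54 * b ^+ 3 = -1) a0.
Proof.
pose p : {poly R} := 54%:R%:P * 'X^3 - 27%:R%:P * 'X^2 - 1%:P.
have pE b : p.[b] = 54 * b ^+ 3 - 27 * b ^+ 2 - 1 by rewrite /p !hornerE.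
have [||b b01 /rootP] := @poly_ivt _ p (1 / 2) (2 / 3).
- lra.
- by rewrite !pE; apply/andP; split; lra.
rewrite pE => pb; exists b; split; last first.
  move=> c [c01 pc].
  have : (b - c) * (54 * (b ^+ 2 + b * c + c ^+ 2) - 27 * (b + c)) = 0.
    by move: pb pc; rewrite !exprS !expr0; lra.
  move/eqP; rewrite mulf_eq0 subr_eq0 => /orP[/eqP //|/eqP].
  move: b01 c01; rewrite !in_itv /=; nra.
split; last by lra.
move: b01; rewrite !in_itv /= => /andP[b0 b1]; apply/andP; split.
  by rewrite lt_neqAle b0 andbT; apply/eqP => bE; move: pb; rewrite -bE; lra.
by rewrite lt_neqAle b1 andbT; apply/eqP => bE; move: pb; rewrite bE; lra.
Qed.

Theorem mainTheorem2 (R : realType) :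
  exists2 a0 : R,
    unique (fun b : R => (b \in `]1 / 2, 2 / 3[) /\
                         27 * b ^+ 2 - 54 * b ^+ 3 = -1) a0 &
    forall (a : R) (f : nat -> R -> R),
      a \in `]0, 1[ -> okamoto_approximants a f ->
      [/\ a \in `[a0, 1[ ->
            {ae lebesgue_measure, forall x : R, x \in `[0, 1] ->
               ~ derivable01 (limit_fun f) x},
          (a \in `]0, 1 / 3[) \/ (a \in `]1 / 3, a0[) ->
            {ae lebesgue_measure, forall x : R, x \in `[0, 1] ->
               is_derive01 (limit_fun f) x 0} &
          a = 1 / 3 ->
            forall x : R, x \in `[0, 1] -> is_derive01 (limit_fun f) x 1].
Proof.
have [a0 a0P] := critical_ratio R; exists a0 => // a f.
have [[]] := a0P; rewrite in_itv /= => /andP[a0_gt a0_lt] a0E _.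
rewrite in_itv /= => a01 H; have /andP[a_gt0 a_lt1] := a01.
split.
- rewrite in_itv /= => /andP[le_a _].
  have a2 : 1 / 2 < a < 1 by apply/andP; split; lra.
  have crit : 1 <= (3 * a) ^+ 2 * (3 * (2 * a - 1)).
    have : 0 <= (a - a0) * (54 * (a ^+ 2 + a * a0 + a0 ^+ 2) - 27 * (a + a0)).
      by rewrite mulr_ge0 ?subr_ge0 //; nra.
    by move: a0E; rewrite !exprS !expr0; lra.
  have : lebesgue_measure.-negligible ([set x : R | (0 <= x < 1) /\
      exists N, forall n, (N <= n)%N -> (n < 3 * ones n (cell n x))%N]
      `|` [set 1]).
    apply: negligibleU; first exact: negligible_low_walk.
    by apply/negligibleP => //; exact: lebesgue_measure_set1.
  apply: negligibleS => x /= bad.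
  have x01 : x \in `[0, 1] by apply: contrapT => nx; apply: bad => /nx.
  have dF : derivable01 (limit_fun f) x by apply: contrapT => nd; apply: bad.
  have [->|x1] := eqVneq x 1; first by right.
  have x01' : 0 <= x < 1.
    by move: x01; rewrite in_itv /= => /andP[-> ?]; rewrite lt_neqAle x1.
  left; split => //.
  exact: (derivable01_low_walk _ _ _ _ a2 crit H).
- move=> a_sub.
  have p0 : 0 < 3 * a by lra.
  have q0 : 0 <= `|3 * (1 - 2 * a)| by [].
  have sub1 : (3 * a) ^+ 2 * `|3 * (1 - 2 * a)| < 1.
    case: (leP a (1 / 2)) => a2.
      rewrite ger0_norm; last by lra.
      have : 0 < (3 * a - 1) ^+ 2 * (6 * a + 1).
        rewrite mulr_gt0 //; last by lra.
        rewrite exprn_even_gt0 //= subr_eq0; apply/eqP => aE.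
        by case: a_sub; rewrite in_itv /=; lra.
      by rewrite !exprS !expr0; lra.
    rewrite ler0_norm; last by lra.
    have lt_a : a < a0 by case: a_sub; rewrite in_itv /=; lra.
    have : 0 < (a0 - a) * (54 * (a ^+ 2 + a * a0 + a0 ^+ 2) - 27 * (a + a0)).
      by rewrite mulr_gt0 ?subr_gt0 //; nra.
    by move: a0E; rewrite !exprS !expr0; lra.
  have [r r01] := negligible_heavy_cells _ _ _ p0 q0 sub1.
  apply: negligibleS => x /= bad.
  have x01 : x \in `[0, 1] by apply: contrapT => nx; apply: bad => /nx.
  apply: contrapT => light; apply: bad => _.
  apply: (is_derive01_eq0 _ _ _ _ _ a01 H x01 r01).
  apply: contrapT => noN; apply: light => N _.
  apply: contrapT => nheavy; apply: noN; exists N => n le_Nn k lt_k xk.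
  rewrite leNgt; apply/negP => heavy; apply: nheavy; exists n => //.
  apply: (mem_fat_cells _ _ _ _ _ _ lt_k _ xk).
  by move: heavy; rewrite normr_digit_prod (gtr0_norm p0).
- move=> aE x x01; rewrite aE in H.
  apply/is_derive01P => e e0; exists 1 => // y y01 _.
  by rewrite !(limit_fun_third _ _ _ H) // mul1r subrr normr0 mulr_ge0 // ltW.
Qed.
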